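(* Let $\lambda$ be a nonzero complex number. For every integer $n\geq 0$, $$C_{n,\lambda}^* = \frac{C_{n+1,\lambda}(1)-C_{n+1,\lambda}}{n+1},$$ where $C_{n,\lambda}^*$ are the degenerate Cauchy numbers, $C_{n,\lambda}(x)$ are the degenerate Cauchy polynomials of the second kind, and $C_{n,\lambda}=C_{n,\lambda}(0)$.
   Context: All generating functions are formal power series in $t$; $\log(1+u)=\sum_{k\ge 1}\frac{(-1)^{k-1}}{k}u^k$ and $(1+u)^x=\sum_{k\ge 0}x(x-1)\cdots(x-k+1)\frac{u^k}{k!}$. The degenerate Cauchy polynomials of the second kind $C_{n,\lambda}(x)$ are defined by $$\frac{t}{\log\left(1+\frac{1}{\lambda}\log(1+\lambda t)\right)}\left(1+\tfrac{1}{\lambda}\log(1+\lambda t)\right)^x=\sum_{n=0}^\infty C_{n,\lambda}(x)\frac{t^n}{n!},$$ and $C_{n,\lambda}=C_{n,\lambda}(0)$. The degenerate Cauchy numbers $C_{n,\lambda}^*$ are defined by $$\frac{\frac{1}{\lambda}\log(1+\lambda t)}{\log\left(1+\frac{1}{\lambda}\log(1+\lambda t)\right)}=\sum_{n=0}^\infty C_{n,\lambda}^*\frac{t^n}{n!}.$$ *)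

(* Defs.v *)
(* Formal power series over a field, and the generating functions of the
   degenerate Cauchy numbers and polynomials (MathComp). *)
From HB Require Import structures.
From mathcomp Require Import all_boot all_order all_algebra.
From mathcomp Require Import boolp classical_sets.
From mathcomp Require Export reals.
From mathcomp.real_closed Require Export complex.

Set Implicit Arguments.
Unset Strict Implicit.
Unset Printing Implicit Defensive.

Import GRing.Theory.
Local Open Scope ring_scope.

(* A record rather than a bare [nat -> K], whose canonical product is the
   pointwise one. *)
Record fps (K : Type) := Fps { fps_coef : nat -> K }.

Section FpsRing.
Variable K : fieldType.
Implicit Types f g h : fps K.

HB.instance Definition _ := gen_eqMixin (fps K).
HB.instance Definition _ := gen_choiceMixin (fps K).

Lemma fpsP f g : (forall n, fps_coef f n = fps_coef g n) -> f = g.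
Proof. by case: f g => [f] [g] /= /funext->. Qed.

Definition fps_zero : fps K := Fps (fun=> 0).
Definition fps_opp f := Fps (fun n => - fps_coef f n).
Definition fps_add f g := Fps (fun n => fps_coef f n + fps_coef g n).

Fact fps_addA : associative fps_add.
Proof. by move=> f g h; apply: fpsP => n /=; rewrite addrA. Qed.
Fact fps_addC : commutative fps_add.
Proof. by move=> f g; apply: fpsP => n /=; rewrite addrC. Qed.
Fact fps_add0 : left_id fps_zero fps_add.
Proof. by move=> f; apply: fpsP => n /=; rewrite add0r. Qed.
Fact fps_addN : left_inverse fps_zero fps_opp fps_add.
Proof. by move=> f; apply: fpsP => n /=; rewrite addNr. Qed.

HB.instance Definition _ :=
  GRing.isZmodule.Build (fps K) fps_addA fps_addC fps_add0 fps_addN.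

Definition fpsC (c : K) : fps K := Fps (fun n => if n == 0%N then c else 0).
Definition fps_mul f g :=
  Fps (fun n => \sum_(i < n.+1) fps_coef f i * fps_coef g (n - i)).

Fact fps_mulC : commutative fps_mul.
Proof.
move=> f g; apply: fpsP => n /=; rewrite (reindex_inj rev_ord_inj) /=.
by apply: eq_bigr => i _; rewrite subSS subKn -1?ltnS // mulrC.
Qed.

Fact fps_mulA : associative fps_mul.
Proof.
move=> f g h; apply: fpsP => i /=.
pose c3 j k := fps_coef f j * (fps_coef g (i - j - k) * fps_coef h k).
transitivity (\sum_(j < i.+1) \sum_(k < i.+1 | (k <= i - j)%N) c3 j k).
  apply: eq_bigr => /= j _.
  rewrite -[\sum_(_ < _) _]/(fps_coef (fps_mul g h) (i - j)) fps_mulC /=.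
  rewrite big_distrr /= (big_ord_narrow_leq (leq_subr _ _)).
  by apply: eq_bigr => k _; rewrite /c3 (mulrC (fps_coef h _)).
rewrite -[RHS]/(fps_coef (fps_mul (fps_mul f g) h) i) fps_mulC /=.
rewrite (exchange_big_dep predT) //=; apply: eq_bigr => k _.
transitivity (\sum_(j < i.+1 | (j <= i - k)%N) c3 j k).
  apply: eq_bigl => j; rewrite -ltnS -(ltnS j) -!subSn ?leq_ord //.
  by rewrite -subn_gt0 -(subn_gt0 j) -!subnDA addnC.
rewrite (big_ord_narrow_leq (leq_subr _ _)) big_distrr /=.
by apply: eq_bigr => j _; rewrite /c3 -!subnDA addnC mulrA mulrC.
Qed.

Fact fps_mul1 : left_id (fpsC 1) fps_mul.
Proof.
move=> f; apply: fpsP => n /=; rewrite big_ord_recl /= mul1r subn0.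
by rewrite big1 ?addr0 // => i _; rewrite mul0r.
Qed.

Fact fps_mulDl : left_distributive fps_mul fps_add.
Proof.
move=> f g h; apply: fpsP => n /=; rewrite -big_split /=.
by apply: eq_bigr => i _; rewrite mulrDl.
Qed.

Fact fps_oner_neq0 : fpsC 1 != 0.
Proof. by apply/eqP => -[/(congr1 (@^~ 0%N))] /=; apply/eqP/oner_neq0. Qed.

HB.instance Definition _ := GRing.Zmodule_isComNzRing.Build (fps K)
  fps_mulA fps_mulC fps_mul1 fps_mulDl fps_oner_neq0.

Definition fpsX : fps K := Fps (fun n => (n == 1%N)%:R).

(* The substitution f(u) = \sum_k f_k u^k. It is meaningful when u has no
   constant term: then u^k contributes to the coefficient of t^n only for
   k <= n, whence the truncation. *)
Definition fps_comp f u :=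
  Fps (fun n => \sum_(k < n.+1) fps_coef f k * fps_coef (u ^+ k) n).

(* The quotient f / g is the power series q with q * g = f; the denominator may
   have a zero constant term (see fps_divXK and fps_div_eq below). *)
Definition fps_div f g : fps K := xget 0 [set q : fps K | q * g = f].

Lemma fps_coefM f g n :
  fps_coef (f * g) n = \sum_(i < n.+1) fps_coef f i * fps_coef g (n - i).
Proof. by []. Qed.

Lemma fps_neq0 f : f != 0 -> exists n, fps_coef f n != 0.
Proof.
move=> f0; apply: contrapT => /forallNP h; case/eqP: f0; apply: fpsP => n.
by apply/eqP; apply: contrapT => /negP /h.
Qed.

Lemma fps_mulf_neq0 f g : f != 0 -> g != 0 -> f * g != 0.
Proof.
move=> /fps_neq0 exf /fps_neq0 exg.
case: (ex_minnP exf) => m fm minm; case: (ex_minnP exg) => n gn minn.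
apply/eqP => -[/(congr1 (@^~ (m + n)%N))] /=.
have lt_m : (m < (m + n).+1)%N by rewrite ltnS leq_addr.
rewrite (bigD1 (Ordinal lt_m)) //= addKn big1 ?addr0.
  by apply/eqP; rewrite mulf_neq0.
move=> i; rewrite -val_eqE /= => ne.
case: (ltngtP i m) ne => // [lt_im|lt_mi] _.
  case: (eqVneq (fps_coef f i) 0) => [->|/minm]; first by rewrite mul0r.
  by rewrite leqNgt lt_im.
case: (eqVneq (fps_coef g (m + n - i)) 0) => [->|/minn]; first by rewrite mulr0.
rewrite leqNgt => /negP[]; rewrite ltn_subLR ?ltn_add2r //.
by rewrite -ltnS ltn_ord.
Qed.

Lemma fps_mulIf g : g != 0 -> injective (fun q : fps K => q * g).
Proof.
move=> g0 p q /= /eqP; rewrite -subr_eq0 -mulrBl => h; apply/eqP.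
by rewrite -subr_eq0; apply: contraTT h => h; apply: fps_mulf_neq0.
Qed.

Lemma fps_div_eq f g q : g != 0 -> q * g = f -> fps_div f g = q.
Proof.
move=> g0 e; apply: xget_unique => //= p pe.
by apply: (fps_mulIf g0); rewrite /= pe e.
Qed.

Fixpoint fps_inv_seq g n : seq K :=
  if n is m.+1 then
    let s := fps_inv_seq g m in
    rcons s ((fps_coef g 0)^-1 *
      ((m == 0%N)%:R - \sum_(i < m) s`_i * fps_coef g (m - i)))
  else [::].

Lemma fps_unit_inv g : fps_coef g 0 != 0 -> exists h, h * g = 1.
Proof.
move=> g0; pose s := fps_inv_seq g; exists (Fps (fun n => (s n.+1)`_n)).
have sz n : size (s n) = n by elim: n => //= n IH; rewrite size_rcons IH.
have nths n i : (i < n)%N -> (s n)`_i = (s i.+1)`_i.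
  elim: n => // n IH; rewrite ltnS leq_eqVlt => /predU1P[->//|lt_in].
  by rewrite -(IH lt_in) [s n.+1]/(rcons _ _) nth_rcons sz lt_in.
apply: fpsP => n; rewrite fps_coefM big_ord_recr /= subnn.
rewrite -/(s n) nth_rcons sz ltnn eqxx mulrAC mulVf // mul1r.
rewrite (eq_bigr (fun i : 'I_n => (s n)`_i * fps_coef g (n - i))).
  by rewrite addrC subrK; case: n.
by move=> i _; rewrite (nths n).
Qed.

Lemma fps_divXK f g : fps_coef f 0 = 0 -> fps_coef g 0 = 0 ->
  fps_coef g 1 != 0 -> fps_div f g * g = f.
Proof.
pose sh h : fps K := Fps (fun n => fps_coef h n.+1).
have shK h : fps_coef h 0 = 0 -> h = fpsX * sh h.
  move=> h0; apply: fpsP => -[|n]; rewrite fps_coefM.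
    by rewrite big_ord1 /= mul0r.
  rewrite 2!big_ord_recl /= mul0r add0r mul1r big1 ?addr0 ?subn1 //.
  by move=> i _; rewrite mul0r.
move=> f0 g0 g1; have [h hg] := @fps_unit_inv (sh g) g1.
have e : sh f * h * g = f by rewrite (shK g) // mulrCA -mulrA hg mulr1 -shK.
by apply: (@xgetI _ _ [set q : fps K | q * g = f] _ e).
Qed.

End FpsRing.

Arguments fpsX {K}.

Section DegenerateCauchy.
(* Intended for K of characteristic 0: the series below divide by integers. *)
Variable K : fieldType.
Implicit Types (u : fps K) (x lam : K).

Definition fps_log1p u : fps K :=
  fps_comp
    (Fps (fun k => if k == 0%N then 0 else (-1) ^+ k.-1 / k%:R)) u.

Definition fps_pow1p u x : fps K :=
  fps_comp (Fps (fun k => (\prod_(i < k) (x - i%:R)) / k`!%:R)) u.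

Definition deg_log lam : fps K := fpsC lam^-1 * fps_log1p (fpsC lam * fpsX).

Definition egf_coef (f : fps K) n : K := n`!%:R * fps_coef f n.

Definition deg_Cauchy2_poly lam n x : K :=
  egf_coef (fps_div fpsX (fps_log1p (deg_log lam))
            * fps_pow1p (deg_log lam) x) n.

Definition deg_Cauchy2 lam n : K := deg_Cauchy2_poly lam n 0.

Definition deg_Cauchy_star lam n : K :=
  egf_coef (fps_div (deg_log lam) (fps_log1p (deg_log lam))) n.

End DegenerateCauchy.

(* Main.v *)
Require Import Defs.
From mathcomp Require Import all_boot all_order all_algebra.
Import GRing.Theory.
Local Open Scope ring_scope.

(** With u = deg_log lam and g = log(1 + u), the binomial series gives
    (1 + u)^1 - (1 + u)^0 = u, so the generating function of the differences
    C_n(1) - C_n(0) is (t / g) u = t (u / g), and u / g is the generating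
    function of the C*_n. *)

Section PowerSeries.
Variable K : fieldType.
Implicit Types (f g u : fps K) (c lam : K).

Lemma fps_coefD f g n : fps_coef (f + g) n = fps_coef f n + fps_coef g n.
Proof. by []. Qed.

Lemma fps_coefCM c f n : fps_coef (fpsC c * f) n = c * fps_coef f n.
Proof.
rewrite fps_coefM big_ord_recl /= subn0 big1 ?addr0 // => i _.
by rewrite mul0r.
Qed.

Lemma fps_coefXMS f n : fps_coef (fpsX * f) n.+1 = fps_coef f n.
Proof.
rewrite fps_coefM 2!big_ord_recl /= mul0r add0r mul1r subn1 big1 ?addr0 //.
by move=> i _; rewrite mul0r.
Qed.

(** Multiplied by [g], both sides become [f1 * f2], and a nonzero [g] cancels. The conditions on low
    coefficients ensure that both quotients exist. *)
Lemma fps_div_mulC f1 f2 g : fps_coef f1 0 = 0 -> fps_coef f2 0 = 0 ->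
  fps_coef g 0 = 0 -> fps_coef g 1 != 0 ->
  fps_div f1 g * f2 = f1 * fps_div f2 g.
Proof.
move=> f10 f20 g0 g1.
have gn0 : g != 0 by apply: contraNneq g1 => ->.
apply: (fps_mulIf gn0) => /=.
by rewrite mulrAC fps_divXK // -mulrA fps_divXK.
Qed.

Lemma fps_log1p0 u : fps_coef (fps_log1p u) 0 = 0.
Proof. by rewrite /= big_ord1 mul0r. Qed.

(** Supplies the nonzero linear coefficient that a denominator log(1 + u) must have. *)
Lemma fps_log1p1 u : fps_coef (fps_log1p u) 1 = fps_coef u 1.
Proof.
by rewrite /= big_ord_recl big_ord1 /= mul0r add0r expr0 divr1 mul1r expr1.
Qed.

Lemma fps_pow1p0 u : fps_pow1p u 0 = 1.
Proof.
apply: fpsP => n; rewrite /= big_ord_recl /= big_ord0 divr1 mul1r.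
by rewrite big1 ?addr0 // => i _; rewrite big_ord_recl /= subr0 !mul0r.
Qed.

Lemma fps_pow1p1 u : fps_coef u 0 = 0 -> fps_pow1p u 1 = 1 + u.
Proof.
move=> u0; apply: fpsP => -[|n].
  (* In degree 0 the truncated substitution keeps only k = 0, so matching 1 + u requires [u0]. *)
  by rewrite /= big_ord1 /= big_ord0 divr1 mul1r u0 addr0.
rewrite /= 2!big_ord_recl /= big_ord0 big_ord1 /= subr0 !divr1 !mul1r.
(* For k >= 2 the falling factorial of 1 contains the factor 1 - 1. *)
rewrite big1 ?addr0 // => i _.
by rewrite 2!big_ord_recl /= subrr mul0r mulr0 !mul0r.
Qed.

Lemma deg_log0 lam : fps_coef (deg_log lam) 0 = 0.
Proof. by rewrite fps_coefCM fps_log1p0 mulr0. Qed.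

Lemma deg_log1 lam : lam != 0 -> fps_coef (deg_log lam) 1 = 1.
Proof. by move=> lam0; rewrite fps_coefCM fps_log1p1 fps_coefCM mulr1 mulVf. Qed.

Lemma deg_Cauchy2_poly_diff lam n : lam != 0 ->
  deg_Cauchy2_poly lam n.+1 1 - deg_Cauchy2 lam n.+1 =
  n.+1%:R * deg_Cauchy_star lam n.
Proof.
move=> lam0; have u0 := deg_log0 lam.
rewrite /deg_Cauchy2 /deg_Cauchy2_poly /egf_coef fps_pow1p0.
rewrite fps_pow1p1 // mulrDr mulr1.
(* Turns (t / g) u into t (u / g), with g of linear coefficient 1. *)
rewrite fps_div_mulC ?fps_log1p0 ?fps_log1p1 ?deg_log1 ?oner_neq0 //.
rewrite -mulrBr fps_coefD addrC addKr fps_coefXMS.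
(* The factor t lowered the index to n, so (n+1)! = (n+1) n! leaves the factor n + 1. *)
by rewrite factS natrM -mulrA.
Qed.

End PowerSeries.

Theorem theorem2p7 (R : realType) (lam : R[i]) (hlam : lam != 0) (n : nat) :
  deg_Cauchy_star lam n =
  (deg_Cauchy2_poly lam n.+1 1 - deg_Cauchy2 lam n.+1) / n.+1%:R.
Proof.
(* Characteristic 0 makes n + 1 invertible. *)
by rewrite deg_Cauchy2_poly_diff // mulrC mulKf // Num.Theory.pnatr_eq0.
Qed.
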